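(* Let $K^P=\operatorname{diag}(K_1^P,\dots,K_n^P)$ with all $K_i^P>0$. A sufficient condition for $$\lambda_{\min}\!\left(\mathcal L_c(K^P)^{-1}\mathcal L_R+\mathcal L_R(K^P)^{-1}\mathcal L_c\right)\ge 0$$ is that $\mathcal L_c=\mathcal L_R$, i.e. that the topology of the communication network is identical to the topology of the power transmission lines and the edge weights of the two graphs are identical.
   Context: $\mathcal L_R$ is the weighted Laplacian matrix of a connected undirected graph on $\{1,\dots,n\}$ (the power transmission lines) with edge weights $1/R_{ij}$, $R_{ij}=R_{ji}>0$. $\mathcal L_c$ is the weighted Laplacian matrix of a connected undirected graph on $\{1,\dots,n\}$ (the communication network) with edge weights $c_{ij}=c_{ji}>0$. $\lambda_{\min}$ denotes the smallest eigenvalue of a symmetric matrix. *)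

(* Defs.v *)
From mathcomp Require Import all_boot all_order all_algebra.
From mathcomp Require Import reals.

Set Implicit Arguments.
Unset Strict Implicit.
Unset Printing Implicit Defensive.

Import Order.TTheory GRing.Theory Num.Theory.
Local Open Scope ring_scope.

(* Undirected graphs on {1, ..., n} have vertex type 'I_n and no self-loops.  *)
Definition connected_undirected n (e : rel 'I_n) : Prop :=
  [/\ symmetric e, irreflexive e & forall i j, connect e i j].

(* Only the values of w on the edges of e carry meaning. *)
Definition edge_weights (R : realType) n (e : rel 'I_n) (w : 'I_n -> 'I_n -> R)
    : Prop :=
  forall i j, e i j -> w i j = w j i /\ 0 < w i j.

Definition laplacian (R : realType) n (e : rel 'I_n) (w : 'I_n -> 'I_n -> R)
    : 'M[R]_n :=
  \matrix_(i, j) if i == j then \sum_(k | e i k) w i k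
                 else if e i j then - w i j else 0.

(* For the symmetric matrices considered here all complex eigenvalues are     *)
(* real, and left eigenvalues (as in [eigenvalue]) are right eigenvalues.     *)
Definition is_lambda_min (R : realType) n (A : 'M[R]_n) (l : R) : Prop :=
  eigenvalue A l /\ forall mu, eigenvalue A mu -> l <= mu.

Definition same_weighted_graph (R : realType) n (e1 e2 : rel 'I_n)
    (w1 w2 : 'I_n -> 'I_n -> R) : Prop :=
  e1 =2 e2 /\ forall i j, e1 i j -> w1 i j = w2 i j.

(* Main.v *)
(* When L_c = L_R = L, the matrix 2 L K^-1 L is positive semidefinite, and it
   kills the constant vectors, so that its smallest eigenvalue is exactly 0. *)
Require Import Defs.
From mathcomp Require Import all_boot all_order all_algebra.
From mathcomp Require Import reals.

Set Implicit Arguments.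
Unset Strict Implicit.
Unset Printing Implicit Defensive.

Import Order.TTheory GRing.Theory Num.Theory.
Local Open Scope ring_scope.

(** If both Laplacians equal [L], symmetry of [L] gives [v (2 L K^-1 L) v^T = 2 (v L) K^-1 (v L)^T],
    which is nonnegative because [K] is positive ([invmx_diag_form_ge0]); hence no eigenvalue is
    negative ([eigenvalue_ge0]). Constant vectors lie in the kernel of [L] ([const_mul_laplacian]),
    so 0 is attained and is the minimum, with no appeal to the spectral theorem. That equal matrices
    mean equal weighted graphs is [laplacian_inj] with its converse [eq_laplacian]. *)

Section Laplacian.
Variables (R : realType) (n : nat).
Implicit Types (e : rel 'I_n) (w : 'I_n -> 'I_n -> R) (d u v : 'rV[R]_n).

Lemma trmx_laplacian e w :
  symmetric e -> (forall i j, e i j -> w i j = w j i) ->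
  (laplacian e w)^T = laplacian e w.
Proof.
move=> esym wsym; apply/matrixP => i j; rewrite !mxE [j == i]eq_sym.
case: eqP => [->//|_]; rewrite esym.
by case: ifP => // eij; rewrite wsym // esym.
Qed.

Lemma laplacian_row_sum e w i :
  irreflexive e -> \sum_j laplacian e w i j = 0.
Proof.
(* The degree on the diagonal becomes a sum over all [j] different from [i], which cancels the
   off-diagonal entries term by term. *)
move=> eirr; rewrite (bigD1 i) //= mxE eqxx big_mkcond (bigD1 i) //= eirr add0r.
rewrite -big_split big1 //= => j ji.
by rewrite mxE eq_sym (negPf ji); case: ifP => _; rewrite ?subrr ?addr0.
Qed.

Lemma const_mul_laplacian e w (a : R) :
  symmetric e -> irreflexive e -> (forall i j, e i j -> w i j = w j i) ->
  (const_mx a : 'rV_n) *m laplacian e w = 0.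
Proof.
move=> esym eirr wsym; rewrite -(trmx_laplacian esym wsym).
apply/rowP => i; rewrite !mxE.
under eq_bigr => j _ do rewrite mxE [_^T _ _]mxE.
by rewrite -mulr_sumr laplacian_row_sum ?mulr0.
Qed.

(** Off-diagonal entries reveal the graph: with nonzero weights, an entry vanishes exactly off the
    edges, and otherwise is minus the weight. *)
Lemma laplacian_inj e1 e2 w1 w2 :
  irreflexive e1 -> irreflexive e2 ->
  (forall i j, e1 i j -> w1 i j != 0) -> (forall i j, e2 i j -> w2 i j != 0) ->
  laplacian e1 w1 = laplacian e2 w2 -> same_weighted_graph e1 e2 w1 w2.
Proof.
move=> irr1 irr2 nz1 nz2 /matrixP eqL.
have H i j : e1 i j = e2 i j /\ (e1 i j -> w1 i j = w2 i j).
  have [->|ij] := eqVneq i j; first by rewrite irr1 irr2.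
  move: (eqL i j); rewrite !mxE (negPf ij).
  case: ifP => [/nz1 nz|_]; case: ifP => [/nz2 nz'|_] //.
  - by move/oppr_inj.
  - by move/eqP; rewrite oppr_eq0 (negPf nz).
  - by move/esym/eqP; rewrite oppr_eq0 (negPf nz').
by split=> i j; have [] := H i j.
Qed.

Lemma eq_laplacian e1 e2 w1 w2 :
  same_weighted_graph e1 e2 w1 w2 -> laplacian e1 w1 = laplacian e2 w2.
Proof.
case=> eqe eqw; apply/matrixP => i j; rewrite !mxE -eqe.
case: ifP => _; last by case: ifP => // /eqw->.
by apply: eq_big => k; [exact: eqe | exact: eqw].
Qed.

Lemma diag_form_ge0 d u :
  (forall i, 0 <= d 0 i) -> 0 <= (u *m diag_mx d *m u^T) 0 0.
Proof.
move=> d_ge0; rewrite mul_mx_diag mxE sumr_ge0 // => i _.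
by rewrite !mxE mulrAC mulr_ge0 // -expr2 sqr_ge0.
Qed.

Lemma invmx_diag_form_ge0 d u :
  (forall i, 0 < d 0 i) -> 0 <= (u *m invmx (diag_mx d) *m u^T) 0 0.
Proof.
move=> d_gt0.
have dU : diag_mx d \in unitmx.
  by rewrite unitmxE det_diag unitfE gt_eqF // prodr_gt0.
(* With [D = diag_mx d] and [y = u D^-1], the form becomes [y D y^T]. *)
rewrite -[u in u^T](mulmxKV dU) trmx_mul tr_diag_mx mulmxA.
by apply: diag_form_ge0 => i; exact: ltW.
Qed.

(** Pairing [v A = mu v] with [v^T] gives [mu |v|^2 >= 0], and [|v|^2 > 0]. *)
Lemma eigenvalue_ge0 (A : 'M[R]_n) (mu : R) :
  (forall v, 0 <= (v *m A *m v^T) 0 0) -> eigenvalue A mu -> 0 <= mu.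
Proof.
move=> A_ge0 /eigenvalueP[v vA v_neq0].
have := A_ge0 v; rewrite vA -scalemxAl mxE pmulr_lge0 //.
have [i vi] : exists i, v 0 i != 0 by apply/rV0Pn.
rewrite mxE (bigD1 i) //= mxE -expr2 ltr_pwDl //.
  by rewrite lt_def sqrf_eq0 vi sqr_ge0.
by apply: sumr_ge0 => j _; rewrite mxE -expr2 sqr_ge0.
Qed.

End Laplacian.

Theorem corollary8 (R : realType) (n : nat) (hn : (0 < n)%N)
    (eR eC : rel 'I_n) (res c : 'I_n -> 'I_n -> R) (K : 'rV[R]_n)
    (heR : connected_undirected eR) (hres : edge_weights eR res)
    (heC : connected_undirected eC) (hc : edge_weights eC c)
    (hK : forall i, 0 < K 0 i) :
  let LR := laplacian eR (fun i j => (res i j)^-1) in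
  let Lc := laplacian eC c in
  let KP := diag_mx K in
  (Lc = LR <-> same_weighted_graph eC eR c (fun i j => (res i j)^-1))
  /\ (Lc = LR ->
      exists2 l : R,
        is_lambda_min (Lc *m invmx KP *m LR + LR *m invmx KP *m Lc) l
        & 0 <= l).
Proof.
move=> LR Lc KP.
have [_ irrR _] := heR; have [symC irrC _] := heC.
have res_gt0 i j : eR i j -> 0 < (res i j)^-1.
  by move=> /hres[_]; rewrite invr_gt0.
have c_sym i j : eC i j -> c i j = c j i by move=> /hc[].
split; first split.
- apply: laplacian_inj => // i j eij; rewrite gt_eqF //; last exact: res_gt0.
  by have [] := hc _ _ eij.
- exact: eq_laplacian.
move=> <-; exists 0 => //; split.
  (* The all-ones row is killed by the leftmost Laplacian of each summand; it is nonzero since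
     [n > 0]. *)
  apply/eigenvalueP; exists (const_mx 1).
    by rewrite mulmxDr !mulmxA const_mul_laplacian // !mul0mx addr0 scale0r.
  by apply/rV0Pn; exists (Ordinal hn); rewrite mxE oner_neq0.
move=> mu; apply: eigenvalue_ge0 => v.
have -> : v *m (Lc *m invmx KP *m Lc + Lc *m invmx KP *m Lc) *m v^T =
    ((v *m Lc) *m invmx KP *m (v *m Lc)^T) *+ 2.
  by rewrite trmx_mul trmx_laplacian // mulmxDr mulmxDl !mulmxA mulr2n.
by rewrite mulr2n mxE addr_ge0 // invmx_diag_form_ge0.
Qed.
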